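(* Let $A\in\mathbb{R}^{n\times m}$ have rank $r$ and be $(\mu_1,\mu_2)$-incoherent, let $p\in(0,1]$, and let $Z$ be the wedge matrix of $A$ at rate $p$ (defined in the context). There is an absolute constant $C>0$ such that for any $a>2$, with probability at least $1-O(n^{-a})$, \[ \|Z-AA^\top\|\le C\left(\sqrt{\frac{a\mu_1\mu_2 r^2\log n}{pmn}}+\frac{a\mu_1\mu_2r^2\log n}{pmn}\right)\|A\|^2 . \]
   Context: $\|\cdot\|$ denotes the spectral (operator) norm. A rank-$r$ matrix $A\in\mathbb{R}^{n\times m}$ with compact SVD $A=U\Sigma V^\top$ ($U\in\mathbb{R}^{n\times r},V\in\mathbb{R}^{m\times r}$) is $(\mu_1,\mu_2)$-incoherent if $\max_i\|U_{i,\cdot}\|_2^2\le \mu_1 r/n$ and $\max_j\|V_{j,\cdot}\|_2^2\le\mu_2 r/m$. Wedge sampling: let $\mathcal W=\{(i,\ell,j):1\le i\le j\le n,\ \ell\in[m]\}$; each triple in $\mathcal W$ is included in $\tilde{\mathcal W}$ independently with probability $p$ (for each sampled triple, the entries $A_{i\ell},A_{j\ell}$ are observed). With $E_{ij}=e_ie_j^\top$ and $Z_{i\ell j}=p^{-1}A_{i\ell}A_{j\ell}E_{ij}\mathbf 1\{(i,\ell,j)\in\tilde{\mathcal W}\}$, the wedge matrix is $Z=\sum_{i<j,\ \ell\in[m]}(Z_{i\ell j}+Z_{i\ell j}^\top)+\sum_{i\in[n],\ell\in[m]}Z_{i\ell i}$, which satisfies $\mathbb E Z=AA^\top$. *)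

(* Defs.v *)
From HB Require Import structures.
From mathcomp Require Import all_boot all_order all_algebra.
From mathcomp Require Import all_classical all_reals.
From mathcomp Require Import exp Rstruct.
Set Implicit Arguments. Unset Strict Implicit. Unset Printing Implicit Defensive.
Import Order.TTheory GRing.Theory Num.Theory.
Local Open Scope ring_scope.

Notation RR := Rdefinitions.R.

Definition vnorm2 (k : nat) (x : 'cV[RR]_k) : RR :=
  Num.sqrt (\sum_(i < k) x i 0 ^+ 2).

Definition spec_norm (n m : nat) (M : 'M[RR]_(n, m)) : RR :=
  sup [set y : RR | exists x : 'cV[RR]_m, vnorm2 x <= 1 /\ y = vnorm2 (M *m x)].

Definition incoherent (n m : nat) (A : 'M[RR]_(n, m)) (r : nat) (mu1 mu2 : RR) : Prop :=
  exists (U : 'M[RR]_(n, r)) (S : 'rV[RR]_r) (V : 'M[RR]_(m, r)),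
    U^T *m U = 1%:M /\ V^T *m V = 1%:M /\ (forall k, 0 < S 0 k) /\
    A = U *m diag_mx S *m V^T /\
    (forall i, \sum_(k < r) U i k ^+ 2 <= mu1 * r%:R / n%:R) /\
    (forall j, \sum_(k < r) V j k ^+ 2 <= mu2 * r%:R / m%:R).

(* Sample space: a subset of triples (i, l, j), encoded as ((i, l), j). *)
Definition Omega (n m : nat) := {ffun 'I_n * 'I_m * 'I_n -> bool}.

Definition inW (n m : nat) (t : 'I_n * 'I_m * 'I_n) : bool := (t.1.1 <= t.2)%N.

(* Probability weight of an outcome: each triple of W is included independently
   with probability p; triples outside W are never included. *)
Definition weight (n m : nat) (p : RR) (w : Omega n m) : RR :=
  \prod_(t : 'I_n * 'I_m * 'I_n)
     (if inW t then (if w t then p else 1 - p) else (if w t then 0 else 1)).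

Definition prob (n m : nat) (p : RR) (E : Omega n m -> Prop) : RR :=
  \sum_(w : Omega n m) (if `[< E w >] then weight p w else 0).

Definition Zilj (n m : nat) (A : 'M[RR]_(n, m)) (p : RR) (w : Omega n m)
  (i : 'I_n) (l : 'I_m) (j : 'I_n) : 'M[RR]_n :=
  (p^-1 * A i l * A j l * (if w ((i, l), j) then 1 else 0)) *: delta_mx i j.

Definition wedge (n m : nat) (A : 'M[RR]_(n, m)) (p : RR) (w : Omega n m) : 'M[RR]_n :=
  \sum_(i < n) \sum_(j < n | (i < j)%N) \sum_(l < m)
      (Zilj A p w i l j + (Zilj A p w i l j)^T)
  + \sum_(i < n) \sum_(l < m) Zilj A p w i l i.

(* Main.v *)
Require Import Defs.
From HB Require Import structures.
From mathcomp Require Import all_boot all_order all_algebra.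
From mathcomp Require Import all_classical all_reals.
From mathcomp Require Import exp Rstruct.
From mathcomp Require Import sequences ring lra zify.
Import Order.TTheory GRing.Theory Num.Theory.
Local Open Scope ring_scope.

(** Put [X := Z - A A^T], a sum over the triples [t] of independent centered
    matrices [(w t - p) B_t], where [B_t] is a multiple of [E_ij + E_ji], so that
    [B_t^2] is diagonal. The proof is a polynomial moment estimate for [X].

    Resampling one coordinate at a time, as in the method of exchangeable pairs,
    gives [E tr X^(2k) <= (2k-1) E tr (D X^(2k-2))] with the diagonal matrix
    [D := sum_t (w t + p) B_t^2]. Log-convexity of [j |-> (X^(2j))_xx] and Young's
    inequality then yield [E tr X^(2k) <= (4k)^k sum_x E D_xx^k]. Each [D_xx] is a
    sum of independent bounded scalars, whose moments obey
    [E D_xx^k <= (2 M + k L)^k], with [M] a variance proxy and [L] an almost sure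
    bound, both read off from the incoherence of [A]. Markov's inequality with [k]
    about [a log n] concludes. *)

(** * Convex and log-convex sequences *)

Section Convexity.
Variable R : realFieldType.

(** If the last step goes down, convexity carries the descent back to every earlier step and [g]
    peaks at [0]; otherwise the bound for [u] is inherited. Nonnegativity lets the sum of the ends
    stand for their maximum. *)
Lemma convex_seq_le_ends (g : nat -> R) (u : nat) :
  (forall s, 0 <= g s) ->
  (forall s, (s.+2 <= u)%N -> g s.+1 *+ 2 <= g s + g s.+2) ->
  forall s, (s <= u)%N -> g s <= g 0 + g u.
Proof.
move=> g0; elim: u => [|u IHu] cvx s.
  by rewrite leqn0 => /eqP->; rewrite lerDl.
rewrite leq_eqVlt ltnS => /orP[/eqP->|su]; first by rewrite lerDr.
have [le_u|/ltW lt_u] := leP (g u) (g u.+1).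
  apply: (le_trans (IHu _ s su)); last by rewrite lerD2l.
  by move=> t tu; apply: cvx; apply: leqW.
have dec t : (t <= u)%N -> g t.+1 <= g t.
  move=> tu; rewrite -(subKn tu); move: (u - t)%N (leq_subr t u) => d {t tu}.
  elim: d => [|d IHd] du; first by rewrite subn0.
  have := cvx (u - d.+1)%N; have := IHd (ltnW du).
  rewrite ltnS subnSK // leq_subr mulr2n => ? /(_ isT); lra.
apply: (@le_trans _ _ (g 0)); last by rewrite lerDl.
elim: s su => // s IHs su; exact: le_trans (dec _ (ltnW su)) (IHs (ltnW su)).
Qed.

(** The ratios [h j.+1 / h j] are nondecreasing, so the bound [c] on the last one holds for all
    earlier ones, and they multiply up. Cross-multiplying accommodates zeros of [h]. *)
Lemma logconvex_ratio_down (h : nat -> R) (c : R) (k : nat) :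
  (forall j, 0 <= h j) -> (forall j, h j.+1 ^+ 2 <= h j * h j.+2) ->
  0 <= c -> h k.+1 <= c * h k -> h k <= c ^+ k * h 0.
Proof.
move=> h0 lc c0 hk.
have dec j : (j <= k)%N -> h j.+1 <= c * h j.
  move=> jk; rewrite -(subKn jk); move: (k - j)%N (leq_subr j k) => d {j jk}.
  elim: d => [|d IHd] dk; first by rewrite subn0.
  have := IHd (ltnW dk); have := lc (k - d.+1)%N; rewrite subnSK // => xx zx.
  have := h0 (k - d)%N; rewrite le0r => /orP[/eqP->|x0].
    by rewrite mulr_ge0 // h0.
  rewrite -(ler_pM2r x0) -expr2; apply: (le_trans xx).
  by rewrite mulrC mulrAC ler_wpM2r ?h0.
elim: {hk} k dec => [|k IHk] dec; first by rewrite expr0 mul1r.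
apply: (le_trans (dec k (leqnSn k))); rewrite exprS -mulrA ler_wpM2l ?IHk //.
by move=> j jk; apply/dec/leqW.
Qed.

(* Young's inequality [D h_k <= h_(k+1) / c + c^k D^(k+1)] cleared of the
   denominator [c]. *)
Lemma logconvex_young (h : nat -> R) (D c : R) (k : nat) :
  (forall j, 0 <= h j) -> (forall j, h j.+1 ^+ 2 <= h j * h j.+2) ->
  h 0 <= 1 -> 0 <= D -> 0 <= c ->
  c * D * h k <= h k.+1 + (c * D) ^+ k.+1.
Proof.
move=> h0 lc h01 D0 c0; have cD0 : 0 <= c * D by rewrite mulr_ge0.
have [le1|/ltW le2] := leP (c * D * h k) (h k.+1).
  by rewrite (le_trans le1) // lerDl exprn_ge0.
rewrite -[leLHS]add0r lerD ?h0 // exprS ler_wpM2l //.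
apply: le_trans (logconvex_ratio_down _ _ _ h0 lc cD0 le2) _.
by rewrite ler_piMr // exprn_ge0.
Qed.

(** Every ratio [h j.+1 / h j] is at least the first one, which is at least [h 1] because
    [h 0 <= 1]. *)
Lemma logconvex_exp_le (h : nat -> R) (k : nat) :
  (forall j, 0 <= h j) -> (forall j, h j.+1 ^+ 2 <= h j * h j.+2) ->
  h 0 <= 1 -> h 1%N ^+ k.+1 <= h k.+1.
Proof.
move=> h0 lc h01.
have up j : h j * h 1%N <= h j.+1 * h 0%N.
  elim: j => [|j IHj]; first by rewrite mulrC.
  have := h0 j.+1; rewrite le0r => /orP[/eqP->|pj].
    by rewrite mul0r mulr_ge0.
  rewrite -(ler_pM2l pj) mulrA -expr2.
  apply: (@le_trans _ _ (h j * h j.+2 * h 1%N)); first by rewrite ler_wpM2r ?lc.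
  rewrite mulrAC (mulrC (h j.+2)) mulrA; exact: ler_wpM2r.
elim: k => [|k IHk]; first by rewrite expr1.
rewrite exprSr (@le_trans _ _ (h k.+1 * h 1%N)) //; first by rewrite ler_wpM2r.
by apply: (le_trans (up _)); rewrite ler_piMr.
Qed.

Lemma cauchy_schwarz_sum (I : finType) (x y : I -> R) :
  (\sum_i x i * y i) ^+ 2 <= (\sum_i x i ^+ 2) * (\sum_i y i ^+ 2).
Proof.
(* Lagrange's identity: this double sum is twice the Cauchy-Schwarz gap. *)
have : 0 <= \sum_i \sum_j (x i * y j - x j * y i) ^+ 2.
  by apply: sumr_ge0 => i _; apply: sumr_ge0 => j _; apply: sqr_ge0.
have E : \sum_i \sum_j (x i * y j - x j * y i) ^+ 2 =
  \sum_i \sum_j x i ^+ 2 * y j ^+ 2 + \sum_i \sum_j x j ^+ 2 * y i ^+ 2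
   - (\sum_i \sum_j (x i * y i) * (x j * y j)) *+ 2.
  rewrite -sumrMnl -sumrN -!big_split; apply: eq_bigr => i _ /=.
  rewrite -sumrMnl -sumrN -!big_split; apply: eq_bigr => j _ /=; ring.
rewrite {}E [X in _ + X - _]exchange_big /=.
have -> : \sum_i \sum_j x i ^+ 2 * y j ^+ 2 = (\sum_i x i ^+ 2) * (\sum_i y i ^+ 2).
  by rewrite mulr_suml; apply: eq_bigr => i _; rewrite mulr_sumr.
have -> : \sum_i \sum_j (x i * y i) * (x j * y j) = (\sum_i x i * y i) ^+ 2.
  by rewrite expr2 mulr_suml; apply: eq_bigr => i _; rewrite mulr_sumr.
rewrite mulr2n; lra.
Qed.

End Convexity.

(** * Trace inequalities for symmetric matrices *)

Lemma subrX_telescope (R : pzRingType) (x y : R) (N : nat) :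
  x ^+ N - y ^+ N = \sum_(q < N) x ^+ q * (x - y) * y ^+ (N.-1 - q).
Proof.
elim: N => [|N IHN]; first by rewrite !expr0 subrr big_ord0.
rewrite big_ord_recr /= subnn expr0 mulr1.
have -> : \sum_(q < N) x ^+ q * (x - y) * y ^+ (N - q) = (x ^+ N - y ^+ N) * y.
  rewrite IHN mulr_suml; apply: eq_bigr => q _; rewrite -[RHS]mulrA -exprSr.
  by case: N q {IHN} => [[]//|N] q /=; rewrite -subSn // -ltnS.
by rewrite !exprSr mulrBl mulrBr addrC addrA subrK.
Qed.

Section TraceInequalities.
Variables (R : realFieldType) (n : nat).
Implicit Types (S W Y B M N : 'M[R]_n) (v : 'cV[R]_n).

Lemma trmxM M N : (M * N)^T = N^T * M^T.
Proof. exact: trmx_mul. Qed.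

Lemma mxtraceMC M N : \tr (M * N) = \tr (N * M).
Proof. exact: mxtrace_mulC. Qed.

Lemma trmx_exp M k : (M ^+ k)^T = M^T ^+ k.
Proof.
elim: k => [|k IHk]; first by rewrite !expr0 trmx1.
by rewrite exprS trmxM IHk exprSr.
Qed.

Lemma trmx_exp_sym S k : S^T = S -> (S ^+ k)^T = S ^+ k.
Proof. by rewrite trmx_exp => ->. Qed.

Lemma mxtrace_trM M N : \tr (M^T * N) = \sum_i \sum_j M i j * N i j.
Proof.
rewrite /mxtrace exchange_big /=; apply: eq_bigr => j _.
by rewrite mxE; apply: eq_bigr => i _; rewrite mxE.
Qed.

Lemma mxtrace_trMM_ge0 M : 0 <= \tr (M^T * M).
Proof.
by rewrite mxtrace_trM; do 2!apply: sumr_ge0 => ? _; rewrite -expr2 sqr_ge0.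
Qed.

Lemma mxtrace_AMGM M N :
  \tr (M^T * N) *+ 2 <= \tr (M^T * M) + \tr (N^T * N).
Proof.
rewrite !mxtrace_trM -sumrMnl -big_split; apply: ler_sum => i _ /=.
rewrite -sumrMnl -big_split; apply: ler_sum => j _ /=.
by have := sqr_ge0 (M i j - N i j); rewrite sqrrB mulr2n -!expr2; lra.
Qed.

(* The even terms of the sequence [q |-> \tr (B W^q B Y^(2u - q))] are squared
   Frobenius norms of [W^s B Y^(u-s)]; they form a convex sequence, hence are
   controlled by the two endpoints, and Cauchy-Schwarz covers the odd terms. *)
Lemma mxtrace_exchange_le B W Y (u q : nat) :
  B^T = B -> W^T = W -> Y^T = Y -> (q <= u.*2)%N ->
  \tr (B * W ^+ q * B * Y ^+ (u.*2 - q)) <=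
  \tr (B * B * W ^+ u.*2) + \tr (B * B * Y ^+ u.*2).
Proof.
move=> sB sW sY qu.
pose F s := W ^+ s * B * Y ^+ (u - s).
have trF s t : (s <= u)%N -> (t <= u)%N ->
    \tr ((F s)^T * F t) = \tr (B * W ^+ (s + t) * B * Y ^+ (u.*2 - (s + t))).
  move=> su tu; have -> : (u.*2 - (s + t) = u - t + (u - s))%N.
    by rewrite -addnn addnC subnDA -addnBA // addnC -addnBA // addnC.
  rewrite /F !trmxM !trmx_exp_sym // sB -[in LHS]mulrA mxtraceMC !exprD.
  by rewrite !mulrA.
pose g s := \tr ((F s)^T * F s).
have g0 s : 0 <= g s by exact: mxtrace_trMM_ge0.
have gE : g 0%N + g u =
    \tr (B * B * W ^+ u.*2) + \tr (B * B * Y ^+ u.*2).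
  rewrite /g !trF // addn0 subn0 addnn subnn !expr0 !mulr1 addrC; congr (_ + _).
  by rewrite mxtraceMC mulrA.
have gle : forall s, (s <= u)%N -> g s <= g 0%N + g u.
  apply: convex_seq_le_ends => // s su; rewrite {1}/g.
  rewrite trF ?(ltnW su) // addSnnS -trF ?(ltnW (ltnW su)) //.
  exact: mxtrace_AMGM.
have hu : (q./2 <= u)%N.
  by rewrite -leq_double (leq_trans _ qu) // -{2}(odd_double_half q) leq_addl.
have uu : (uphalf q <= u)%N.
  rewrite uphalf_half; move: qu; rewrite -{1}(odd_double_half q).
  by case: odd; rewrite ?add0n ?add1n ?ltn_double ?leq_double.
rewrite -gE.
have qE : (q./2 + uphalf q)%N = q.
  by rewrite uphalf_half addnCA addnn odd_double_half.
have := mxtrace_AMGM (F q./2) (F (uphalf q)).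
rewrite trF // qE -/(g _) -/(g _) mulr2n.
have := gle _ hu; have := gle _ uu; lra.
Qed.

(** For symmetric [S] this is [v^T S^(2j) v], an even moment of the spectral measure of [S] at [v].
    It provides log-convex sequences without diagonalising [S]. *)
Definition power_energy S v (j : nat) : R := \sum_i ((S ^+ j *m v) i 0) ^+ 2.

Lemma power_energy_ge0 S v j : 0 <= power_energy S v j.
Proof. by apply: sumr_ge0 => i _; apply: sqr_ge0. Qed.

Lemma power_energyE S v j : S^T = S ->
  power_energy S v j = (v^T *m S ^+ j.*2 *m v) 0 0.
Proof.
move=> sS; rewrite -addnn exprD -!mulmxA mulmxA -{1}(trmx_exp_sym S j sS).
by rewrite -trmx_mul mxE; apply: eq_bigr => i _; rewrite [_^T _ _]mxE expr2.
Qed.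

(** Cauchy-Schwarz for [S^j v] and [S^(j+2) v], whose inner product is [|S^(j+1) v|^2] by
    symmetry. *)
Lemma power_energy_logconvex S v j : S^T = S ->
  power_energy S v j.+1 ^+ 2 <= power_energy S v j * power_energy S v j.+2.
Proof.
move=> sS; apply: le_trans (cauchy_schwarz_sum _ _ _ _).
rewrite power_energyE // doubleS -addnn -addnS -addnS exprD -!mulmxA mulmxA.
rewrite -{1}(trmx_exp_sym S j sS) -trmx_mul mxE.
by under eq_bigr do rewrite [_^T _ _]mxE.
Qed.

Lemma power_energy_delta S (x : 'I_n) j : S^T = S ->
  power_energy S (delta_mx x 0) j = (S ^+ j.*2) x x.
Proof.
by move=> sS; rewrite power_energyE // trmx_delta -rowE -colE !mxE.
Qed.

Lemma power_energy_le_trace S v k : S^T = S ->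
  power_energy S v k <= \tr (S ^+ k.*2) * \sum_i v i 0 ^+ 2.
Proof.
move=> sS; rewrite -addnn exprD -{1}(trmx_exp_sym S k sS) mxtrace_trM mulr_suml.
apply: ler_sum => i _; rewrite mxE.
apply: le_trans (cauchy_schwarz_sum _ _ _ _) _; rewrite ler_wpM2r //.
  by apply: sumr_ge0 => j _; apply: sqr_ge0.
Qed.

(** The passage from trace to norm: log-convexity bounds the left side by [|S^(k+1) v|^2], which is
    at most the squared Frobenius norm of [S^(k+1)], that is, the trace. *)
Lemma sqnorm_exp_le_trace S v k : S^T = S -> \sum_i v i 0 ^+ 2 <= 1 ->
  (\sum_i (S *m v) i 0 ^+ 2) ^+ k.+1 <= \tr (S ^+ k.+1.*2).
Proof.
move=> sS v1; have E0 : power_energy S v 0 = \sum_i v i 0 ^+ 2.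
  by rewrite /power_energy expr0 mul1mx.
have -> : \sum_i (S *m v) i 0 ^+ 2 = power_energy S v 1.
  by rewrite /power_energy expr1.
apply: le_trans (logconvex_exp_le _ _ _ (power_energy_ge0 S v) _ _) _.
- by move=> j; exact: power_energy_logconvex.
- by rewrite E0.
apply: le_trans (power_energy_le_trace _ _ _ sS) _.
rewrite ler_piMr // -addnn exprD -{1}(trmx_exp_sym S k.+1 sS).
exact: mxtrace_trMM_ge0.
Qed.

End TraceInequalities.

(** * Products of Bernoulli laws *)

Section BernoulliProduct.
Variables (R : realFieldType) (T : finType) (P : T -> R).
Hypothesis P01 : forall t, 0 <= P t <= 1.
Implicit Types (w : {ffun T -> bool}) (f g : {ffun T -> bool} -> R).

Definition bern (t : T) (b : bool) : R := if b then P t else 1 - P t.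
Definition bweight w : R := \prod_t bern t (w t).
Definition bexp f : R := \sum_w bweight w * f w.
Definition upd w (t : T) (b : bool) : {ffun T -> bool} :=
  [ffun s => if s == t then b else w s].

Lemma bern_ge0 t b : 0 <= bern t b.
Proof. by have /andP[? ?] := P01 t; case: b => //=; rewrite subr_ge0. Qed.

Lemma bweight_ge0 w : 0 <= bweight w.
Proof. by apply: prodr_ge0 => t _; apply: bern_ge0. Qed.

Lemma le_bexp f g : (forall w, f w <= g w) -> bexp f <= bexp g.
Proof. by move=> fg; apply: ler_sum => w _; rewrite ler_wpM2l ?bweight_ge0. Qed.

Lemma bexp_ge0 f : (forall w, 0 <= f w) -> 0 <= bexp f.
Proof. by move=> f0; apply: sumr_ge0 => w _; rewrite mulr_ge0 ?bweight_ge0. Qed.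

Lemma eq_bexp f g : f =1 g -> bexp f = bexp g.
Proof. by move=> fg; apply: eq_bigr => w _; rewrite fg. Qed.

Lemma bexpD f g : bexp (fun w => f w + g w) = bexp f + bexp g.
Proof. by rewrite -big_split; apply: eq_bigr => w _; rewrite mulrDr. Qed.

Lemma bexpB f g : bexp (fun w => f w - g w) = bexp f - bexp g.
Proof. by rewrite -sumrB; apply: eq_bigr => w _; rewrite mulrBr. Qed.

Lemma bexpZ c f : bexp (fun w => c * f w) = c * bexp f.
Proof. by rewrite mulr_sumr; apply: eq_bigr => w _; rewrite mulrCA. Qed.

Lemma bexp_sum (I : finType) (F : I -> {ffun T -> bool} -> R) :
  bexp (fun w => \sum_i F i w) = \sum_i bexp (F i).
Proof. by rewrite exchange_big; apply: eq_bigr => w _; rewrite mulr_sumr. Qed.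

Lemma bexp1 : bexp (fun=> 1) = 1.
Proof.
rewrite /bexp; under eq_bigr do rewrite mulr1.
rewrite -(bigA_distr_bigA bern) big1 // => t _.
by rewrite big_bool /= addrC subrK.
Qed.

(** Flipping coordinate [t] matches the outcomes with [w t != b] to those with [w t = b] and leaves
    the factor [rest] of the weight unchanged; the two weights at [t] add up to 1. *)
Lemma bexp_upd t b f :
  bern t b * bexp (fun w => f (upd w t b)) = bexp (fun w => (w t == b)%:R * f w).
Proof.
pose rest w := \prod_(s | s != t) bern s (w s).
have bE w : bweight w = bern t (w t) * rest w by rewrite /bweight (bigD1 t).
have restE w c : rest (upd w t c) = rest w.
  by apply: eq_bigr => s /negPf st; rewrite ffunE st.
pose flip w := upd w t (~~ w t).
have flipK : involutive flip.
  by move=> w; apply/ffunP => s; rewrite !ffunE eqxx negbK; case: eqP => [->|].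
transitivity (bern t b * \sum_(w : {ffun T -> bool} | w t == b) rest w * f w).
  congr (_ * _); rewrite /bexp (bigID (fun w : {ffun T -> bool} => w t == b)) /=.
  rewrite [X in _ + X](reindex_inj (inv_inj flipK)) /=.
  have -> : \sum_(w | flip w t != b) bweight (flip w) * f (upd (flip w) t b) =
            \sum_(w : {ffun T -> bool} | w t == b) bern t (~~ b) * (rest w * f w).
    apply: eq_big => [w|w].
      by rewrite ffunE eqxx; case: (w t) b => -[].
    rewrite ffunE eqxx => wt; have wb : w t = b by move: wt; case: (w t) b => -[].
    rewrite bE restE ffunE eqxx wb mulrA; congr (_ * f _).
    by apply/ffunP => s; rewrite !ffunE; case: eqP => // ->.
  rewrite -mulr_sumr; under eq_bigr => w /eqP wb.
    rewrite bE wb (_ : upd w t b = w) -?mulrA; last first.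
      by apply/ffunP => s; rewrite ffunE; case: eqP => // ->.
    over.
  by rewrite -mulr_sumr -mulrDl; case: b; rewrite /= ?subrK 1?addrC ?subrK mul1r.
rewrite /bexp [in RHS](bigID (fun w : {ffun T -> bool} => w t == b)) /=.
rewrite [X in _ + X]big1 => [|w /negPf->]; last by rewrite mul0r mulr0.
rewrite addr0 mulr_sumr; apply: eq_bigr => w /eqP wb.
by rewrite bE wb eqxx mul1r mulrA.
Qed.

Lemma bexp_indic t f :
  bexp (fun w => (w t)%:R * f w) = P t * bexp (fun w => f (upd w t true)).
Proof.
rewrite -[P t]/(bern t true) bexp_upd; apply: eq_bexp => w.
by rewrite eqb_id.
Qed.

Lemma bexp_indicC t f :
  bexp (fun w => (~~ w t)%:R * f w) =
  (1 - P t) * bexp (fun w => f (upd w t false)).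
Proof.
rewrite -[1 - P t]/(bern t false) bexp_upd; apply: eq_bexp => w.
by rewrite eqbF_neg.
Qed.

(** A discrete integration by parts: the centered factor becomes a difference in coordinate [t]. *)
Lemma bexp_centered t f :
  bexp (fun w => ((w t)%:R - P t) * f w) =
  P t * (1 - P t) * bexp (fun w => f (upd w t true) - f (upd w t false)).
Proof.
rewrite (@eq_bexp _ (fun w =>
    (1 - P t) * ((w t)%:R * f w) - P t * ((~~ w t)%:R * f w))).
  by rewrite !bexpB !bexpZ bexp_indic bexp_indicC; ring.
by move=> w; case: (w t) => /=; ring.
Qed.

(** Size biasing: one factor of the power is expanded, and each indicator [w t] forces its
    coordinate to be true, which raises the other factors by at most [L]. The shift [s] absorbs this
    raise, so that induction on [k] goes through. *)
Lemma bexp_moment_le (b : T -> R) (L M s : R) (k : nat) :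
  (forall t, 0 <= b t <= L) -> 0 <= L -> \sum_t P t * b t <= M -> 0 <= s ->
  bexp (fun w => (\sum_t (w t)%:R * b t + s) ^+ k) <= (M + s + k%:R * L) ^+ k.
Proof.
move=> bL L0 PM s0.
have M0 : 0 <= M.
  apply: le_trans PM; apply: sumr_ge0 => t _.
  by have /andP[? _] := P01 t; have /andP[? _] := bL t; rewrite mulr_ge0.
pose D w : R := \sum_t (w t)%:R * b t.
have D0 w : 0 <= D w.
  by apply: sumr_ge0 => t _; have /andP[? _] := bL t; rewrite mulr_ge0.
elim: k s s0 => [|k IHk] s s0.
  by rewrite expr0 (eq_bexp _ (fun=> 1)) ?bexp1 // => w; rewrite expr0.
have Dup w t : D (upd w t true) <= D w + L.
  rewrite /D (bigD1 t) //= [leRHS]addrC.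
  rewrite [\sum_(_ : T) _](bigD1 t) //= addrA ffunE eqxx mul1r.
  apply: lerD.
    have /andP[b0 bt] := bL t.
    by rewrite (le_trans bt) // lerDl mulr_ge0.
  by apply: ler_sum => u /negPf ut; rewrite ffunE ut.
have step1 : bexp (fun w => D w * (D w + s) ^+ k) <=
    M * bexp (fun w => (D w + (s + L)) ^+ k).
  rewrite (eq_bexp _ (fun w => \sum_t b t * ((w t)%:R * (D w + s) ^+ k))); last first.
    by move=> w; rewrite {1}/D mulr_suml; apply: eq_bigr => t _; ring.
  rewrite bexp_sum.
  apply: le_trans (ler_wpM2r (bexp_ge0 _ _) PM); last first.
    by move=> w; rewrite exprn_ge0 // !addr_ge0.
  rewrite mulr_suml; apply: ler_sum => t _; rewrite bexpZ bexp_indic.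
  have /andP[? _] := P01 t; have /andP[? _] := bL t.
  rewrite mulrCA -mulrA; do 2!rewrite ler_wpM2l //.
  apply: le_bexp => w; rewrite lerXn2r ?nnegrE ?addr_ge0 //.
  by rewrite addrA addrAC lerD2r.
have step2 : bexp (fun w => (D w + s) ^+ k.+1) <=
    (M + s) * bexp (fun w => (D w + (s + L)) ^+ k).
  rewrite (eq_bexp _ (fun w => D w * (D w + s) ^+ k + s * (D w + s) ^+ k)); last first.
    by move=> w; rewrite exprS mulrDl.
  rewrite bexpD bexpZ mulrDl lerD // ler_wpM2l //.
  apply: le_bexp => w; rewrite lerXn2r ?nnegrE ?addr_ge0 //.
  by rewrite addrA lerDl.
apply: (le_trans step2).
rewrite exprS; apply: ler_pM; rewrite ?addr_ge0 //.
- by apply: bexp_ge0 => w; rewrite exprn_ge0 // !addr_ge0.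
- by rewrite lerDl mulr_ge0.
apply: (le_trans (IHk _ (addr_ge0 s0 L0))).
by rewrite -(natr1 k) mulrDl mul1r addrA -!addrA [L + _]addrC.
Qed.

End BernoulliProduct.
Arguments bern {R T} P t b.
Arguments bweight {R T} P w.
Arguments bexp {R T} P f.
Arguments upd {T} w t b.

(** * Trace moments of centered Bernoulli sums of matrices *)

Section MatrixMoments.
Variables (R : realFieldType) (T : finType) (P : T -> R).
Hypothesis P01 : forall t, 0 <= P t <= 1.
Variables (n : nat) (B : T -> 'M[R]_n).
Hypothesis B_sym : forall t, (B t)^T = B t.
Implicit Types w : {ffun T -> bool}.

Definition bern_mx w : 'M[R]_n := \sum_t ((w t)%:R - P t) *: B t.

Lemma bern_mx_sym w : (bern_mx w)^T = bern_mx w.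
Proof.
by rewrite /bern_mx raddf_sum; apply: eq_bigr => t _ /=; rewrite linearZ /= B_sym.
Qed.

Lemma bern_mx_updB w t :
  bern_mx (upd w t true) - bern_mx (upd w t false) = B t.
Proof.
rewrite /bern_mx (bigD1 t) //= [X in _ - X](bigD1 t) //= !ffunE eqxx.
rewrite [\sum_(_ | _) _](eq_bigr (fun s => ((w s)%:R - P s) *: B s)); last first.
  by move=> s /negPf st; rewrite ffunE st.
rewrite [X in _ - (_ + X)](eq_bigr (fun s => ((w s)%:R - P s) *: B s)); last first.
  by move=> s /negPf st; rewrite ffunE st.
by rewrite opprD addrACA subrr addr0 -scalerBl opprB addrA subrK subr0 scale1r.
Qed.

Lemma mxtrace_sqr_exp_ge0 t w u : 0 <= \tr (B t * B t * bern_mx w ^+ u.*2).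
Proof.
rewrite -addnn exprD mulrA mxtraceMC !mulrA -mulrA.
rewrite -{1}(trmx_exp_sym _ _ _ u (bern_mx_sym w)) -{1}(B_sym t) -trmxM.
exact: mxtrace_trMM_ge0.
Qed.

(* Only the [t]-th summand changes when coordinate [t] is resampled, so the
   centering of [w t] turns [\tr (B t * X ^+ N)] into a difference quotient of
   the power function. *)
Lemma trace_moment_step u :
  bexp P (fun w => \tr (bern_mx w ^+ u.+1.*2)) <=
  u.*2.+1%:R * bexp P (fun w =>
     \sum_t ((w t)%:R + P t) * \tr (B t * B t * bern_mx w ^+ u.*2)).
Proof.
rewrite (eq_bexp _ _ _ _ (fun w =>
    \sum_t ((w t)%:R - P t) * \tr (B t * bern_mx w ^+ u.*2.+1))); last first.
  move=> w; rewrite doubleS exprS {1}/bern_mx mulr_suml raddf_sum /=.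
  by apply: eq_bigr => t _; rewrite -mulmxE -scalemxAl mxtraceZ.
rewrite !bexp_sum mulr_sumr; apply: ler_sum => t _.
rewrite (bexp_centered _ _ _ t (fun w => \tr (B t * bern_mx w ^+ u.*2.+1))).
have /andP[p0 p1] := P01 t; have q0 : 0 <= 1 - P t by rewrite subr_ge0.
pose G w := \tr (B t * B t * bern_mx w ^+ u.*2).
have G0 w : 0 <= G w by exact: mxtrace_sqr_exp_ge0.
(* Telescoping the power gives [2u + 1] terms of the form [B W^q B Y^(2u - q)];
   [mxtrace_exchange_le] bounds each trace by the same two endpoints. *)
have step w : \tr (B t * bern_mx (upd w t true) ^+ u.*2.+1)
    - \tr (B t * bern_mx (upd w t false) ^+ u.*2.+1)
   <= u.*2.+1%:R * (G (upd w t true) + G (upd w t false)).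
  rewrite -raddfB /= -mulrBr subrX_telescope bern_mx_updB mulr_sumr raddf_sum /=.
  rewrite mulr_natl -[X in _ *+ X](card_ord u.*2.+1) -sumr_const.
  apply: ler_sum => q _; rewrite !mulrA.
  by apply: mxtrace_exchange_le => //; rewrite ?bern_mx_sym // -ltnS.
apply: (@le_trans _ _ (P t * (1 - P t) *
    bexp P (fun w => u.*2.+1%:R * (G (upd w t true) + G (upd w t false))))).
  by rewrite ler_wpM2l ?mulr_ge0 //; apply: le_bexp.
rewrite bexpZ mulrCA ler_wpM2l // bexpD.
(* The resampling is undone. The coefficient of [G w] becomes [1 - P t] if [w t] holds and [P t]
   otherwise, hence at most [w t + P t]. *)
have -> : P t * (1 - P t) * (bexp P (fun w => G (upd w t true)) +
    bexp P (fun w => G (upd w t false))) =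
    (1 - P t) * bexp P (fun w => (w t)%:R * G w) +
    P t * bexp P (fun w => (~~ w t)%:R * G w).
  by rewrite bexp_indic bexp_indicC; ring.
rewrite -!bexpZ -bexpD; apply: le_bexp => // w; rewrite -/(G w).
rewrite !mulrA -mulrDl ler_wpM2r //.
case: (w t) => /=; lra.
Qed.

Variable b : T -> 'I_n -> R.
Hypothesis B_sqr : forall t, B t * B t = diag_mx (\row_x b t x).
Variables L M : R.
Hypothesis b_bound : forall t x, 0 <= b t x <= L.
Hypothesis L_ge0 : 0 <= L.
Hypothesis b_var : forall x, \sum_t P t * b t x <= M.

Lemma trace_moment_le u :
  bexp P (fun w => \tr (bern_mx w ^+ u.+1.*2)) <=
  n%:R * (4 * u.+1%:R * (M *+ 2 + u.+1%:R * L)) ^+ u.+1.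
Proof.
pose h w x := power_energy R n (bern_mx w) (delta_mx x 0).
pose D w x := \sum_t ((w t)%:R + P t) * b t x.
(* Twice the factor of [trace_moment_step]: the two estimates then combine to [2 m1 <= m1 + m3], and
   the trace moment [m1] is absorbed. *)
pose c : R := u.*2.+1%:R *+ 2.
have c0 : 0 <= c by rewrite mulrn_wge0.
have P0 t : 0 <= P t by have /andP[] := P01 t.
have b0 t x : 0 <= b t x by have /andP[] := b_bound t x.
have D0 w x : 0 <= D w x.
  by apply: sumr_ge0 => t _; rewrite mulr_ge0 ?addr_ge0.
have trE w j : \tr (bern_mx w ^+ j.*2) = \sum_x h w x j.
  by apply: eq_bigr => x _; rewrite -power_energy_delta ?bern_mx_sym.
have stepE w : \sum_t ((w t)%:R + P t) * \tr (B t * B t * bern_mx w ^+ u.*2)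
    = \sum_x D w x * h w x u.
  under [RHS]eq_bigr do rewrite mulr_suml.
  rewrite exchange_big /=; apply: eq_bigr => t _.
  rewrite B_sqr /mxtrace mulr_sumr; apply: eq_bigr => x _.
  rewrite -mulmxE mul_diag_mx !mxE /h power_energy_delta ?bern_mx_sym //.
  by rewrite mulrA.
have young w : c * (\sum_x D w x * h w x u) <=
    \tr (bern_mx w ^+ u.+1.*2) + \sum_x (c * D w x) ^+ u.+1.
  rewrite trE mulr_sumr -big_split; apply: ler_sum => x _ /=; rewrite mulrA.
  apply: logconvex_young => //.
  - by move=> j; exact: power_energy_ge0.
  - by move=> j; apply: power_energy_logconvex; exact: bern_mx_sym.
  - by rewrite /h power_energy_delta ?bern_mx_sym // double0 expr0 mxE eqxx.
have := trace_moment_step u; rewrite (eq_bexp _ _ _ _ _ stepE).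
have := le_bexp _ _ _ P01 _ _ young; rewrite bexpZ bexpD.
set m1 := bexp P (fun w => \tr _); rewrite !bexp_sum.
set m2 := \sum_x _; set m3 := \sum_x _ => le1 le2.
have {le1 le2} m1le : m1 <= m3.
  by move: le1 le2; rewrite /c mulr2n mulrDl; lra.
apply: (le_trans m1le); rewrite mulr_natl -[X in _ *+ X](card_ord n) -sumr_const.
apply: ler_sum => x _.
have M0 : 0 <= M.
  by apply: le_trans (b_var x); apply: sumr_ge0 => t _; rewrite mulr_ge0.
rewrite (eq_bexp _ _ _ _ (fun w => c ^+ u.+1 * D w x ^+ u.+1)); last first.
  by move=> w; rewrite exprMn.
rewrite bexpZ exprMn; apply: ler_pM.
- exact: exprn_ge0.
- by apply: bexp_ge0 => // w; rewrite exprn_ge0.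
- rewrite lerXn2r ?nnegrE ?mulr_ge0 // /c -mulr_natl -!natrM ler_nat.
  by rewrite -addnn; lia.
(* One [M] bounds the mean of the random part of [D]; the other is the shift, bounding the
   deterministic part [\sum_t P t * b t x]. *)
have -> : M *+ 2 = M + M by rewrite mulr2n.
apply: le_trans (bexp_moment_le _ _ _ P01 (b^~ x) L M M u.+1 _ _ _ _) => //.
apply: le_bexp => // w; rewrite lerXn2r ?nnegrE ?D0 //.
  by rewrite addr_ge0 // sumr_ge0 // => t _; rewrite mulr_ge0.
rewrite /D; under eq_bigr do rewrite mulrDl.
by rewrite big_split lerD2l.
Qed.

End MatrixMoments.
Arguments bern_mx {R T} P {n} B w.

(** * Spectral norm and incoherence *)

Section SpectralNorm.
Variables (n m : nat) (M : 'M[RR]_(n, m)).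

Lemma sqr_vnorm2 (k : nat) (x : 'cV[RR]_k) : vnorm2 x ^+ 2 = \sum_i x i 0 ^+ 2.
Proof. by rewrite sqr_sqrtr // sumr_ge0 // => i _; exact: sqr_ge0. Qed.

Lemma vnorm2_ge0 (k : nat) (x : 'cV[RR]_k) : 0 <= vnorm2 x.
Proof. exact: sqrtr_ge0. Qed.

Lemma vnorm2_le1 (k : nat) (x : 'cV[RR]_k) :
  (vnorm2 x <= 1) = (\sum_i x i 0 ^+ 2 <= 1).
Proof.
by rewrite -sqr_vnorm2 -[in RHS](expr1n _ 2) ler_pXn2r ?nnegrE ?vnorm2_ge0.
Qed.

Lemma vnorm2_mulmx_le_spec_norm (x : 'cV[RR]_m) :
  vnorm2 x <= 1 -> vnorm2 (M *m x) <= spec_norm M.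
Proof.
move=> x1; apply: ub_le_sup; last by exists x.
(* The Frobenius norm bounds the set, so that [sup] is a true supremum. *)
exists (Num.sqrt (\sum_i \sum_j M i j ^+ 2)) => _ [z [z1 ->]].
apply: ler_wsqrtr; apply: ler_sum => i _; rewrite mxE.
apply: le_trans (cauchy_schwarz_sum _ _ _ _) _.
rewrite ler_piMr -?vnorm2_le1 //.
by apply: sumr_ge0 => j _; exact: sqr_ge0.
Qed.

Lemma spec_norm_le (c : RR) :
  (forall x : 'cV[RR]_m, vnorm2 x <= 1 -> vnorm2 (M *m x) <= c) ->
  spec_norm M <= c.
Proof.
move=> Mc; apply: ge_sup => [|_ [x [x1 ->]]]; last exact: Mc.
exists (vnorm2 (M *m 0)), 0; split=> //.
by rewrite vnorm2_le1 big1 // => i _; rewrite mxE expr0n.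
Qed.

Lemma spec_norm_ge0 : 0 <= spec_norm M.
Proof.
apply: le_trans (vnorm2_mulmx_le_spec_norm 0 _); first exact: vnorm2_ge0.
by rewrite vnorm2_le1 big1 // => i _; rewrite mxE expr0n.
Qed.

End SpectralNorm.

Lemma spec_norm_exp_le_trace (n : nat) (S : 'M[RR]_n) (k : nat) (c : RR) :
  S^T = S -> 0 <= c -> \tr (S ^+ k.+1.*2) <= c ^+ k.+1.*2 -> spec_norm S <= c.
Proof.
move=> sS c0 trc; apply: spec_norm_le => x; rewrite vnorm2_le1 => x1.
have := sqnorm_exp_le_trace _ _ _ _ k sS x1.
rewrite -sqr_vnorm2 -exprM mul2n => /le_trans/(_ trc).
by rewrite ler_pXn2r ?nnegrE ?vnorm2_ge0.
Qed.

Lemma sum_sqr_mulmx_tr (R : comNzRingType) (n m r : nat) (X : 'M[R]_(n, r))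
    (Q : 'M[R]_(m, r)) (i : 'I_n) :
  Q^T *m Q = 1%:M -> \sum_l (X *m Q^T) i l ^+ 2 = \sum_k X i k ^+ 2.
Proof.
move=> QQ; transitivity ((X *m Q^T *m (X *m Q^T)^T) i i).
  by rewrite [RHS]mxE; apply: eq_bigr => l _; rewrite [_^T _ _]mxE expr2.
rewrite trmx_mul trmxK mulmxA -[X *m _ *m Q]mulmxA QQ mulmx1 mxE.
by apply: eq_bigr => k _; rewrite [_^T _ _]mxE expr2.
Qed.

(** Row norms of [A] are those of [U S] and column norms are row norms of [V S], by orthonormality
    of the other factor; singular values are at most [spec_norm A]. *)
Lemma incoherent_bounds (n m r : nat) (A : 'M[RR]_(n, m)) (mu1 mu2 : RR) :
  incoherent A r mu1 mu2 ->
  [/\ forall i, \sum_l A i l ^+ 2 <= mu1 * r%:R / n%:R * spec_norm A ^+ 2,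
      forall l, \sum_j A j l ^+ 2 <= mu2 * r%:R / m%:R * spec_norm A ^+ 2 &
      forall i l, A i l ^+ 2 <=
        mu1 * r%:R / n%:R * (mu2 * r%:R / m%:R) * spec_norm A ^+ 2].
Proof.
move=> [U [S [V [UU [VV [S0 [AE [Ub Vb]]]]]]]].
set N := spec_norm A ^+ 2.
(* [A] sends the unit vector [col k V] to [S 0 k] times the unit vector [col k U]. *)
have Sle k : S 0 k ^+ 2 <= N.
  rewrite ler_pXn2r ?nnegrE ?spec_norm_ge0 ?(ltW (S0 _)) //.
  have unit_col (q : nat) (Q : 'M[RR]_(q, r)) : Q^T *m Q = 1%:M ->
      \sum_i Q i k ^+ 2 = 1.
    move=> /matrixP/(_ k k); rewrite !mxE eqxx mulr1n => <-.
    by apply: eq_bigr => i _; rewrite mxE.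
  have vV : vnorm2 (col k V) <= 1.
    by rewrite vnorm2_le1; under eq_bigr do rewrite mxE; rewrite unit_col.
  apply: le_trans (vnorm2_mulmx_le_spec_norm _ _ _ _ vV).
  rewrite -(ler_pXn2r (ltn0Sn 1)) ?nnegrE ?vnorm2_ge0 ?(ltW (S0 _)) //.
  rewrite sqr_vnorm2 colE mulmxA -colE AE -mulmxA VV mulmx1 mul_mx_diag.
  under eq_bigr do rewrite !mxE exprMn.
  by rewrite -mulr_suml unit_col // mul1r.
have AEE i l : A i l = \sum_k U i k * (S 0 k * V l k).
  rewrite AE mxE; apply: eq_bigr => k _; rewrite mul_mx_diag !mxE; ring.
have rsumE i : \sum_l A i l ^+ 2 = \sum_k U i k ^+ 2 * S 0 k ^+ 2.
  rewrite AE sum_sqr_mulmx_tr // mul_mx_diag.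
  by apply: eq_bigr => k _; rewrite mxE exprMn.
have csumE l : \sum_j A j l ^+ 2 = \sum_k V l k ^+ 2 * S 0 k ^+ 2.
  transitivity (\sum_j A^T l j ^+ 2); first by apply: eq_bigr => j _; rewrite mxE.
  rewrite AE !trmx_mul trmxK tr_diag_mx mulmxA sum_sqr_mulmx_tr // mul_mx_diag.
  by apply: eq_bigr => k _; rewrite mxE exprMn.
have N0 : 0 <= N by exact: sqr_ge0.
have Ule i : \sum_k U i k ^+ 2 * S 0 k ^+ 2 <= mu1 * r%:R / n%:R * N.
  apply: le_trans (ler_wpM2r N0 (Ub i)); rewrite mulr_suml.
  by apply: ler_sum => k _; rewrite ler_wpM2l ?sqr_ge0.
have Vle l : \sum_k V l k ^+ 2 * S 0 k ^+ 2 <= mu2 * r%:R / m%:R * N.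
  apply: le_trans (ler_wpM2r N0 (Vb l)); rewrite mulr_suml.
  by apply: ler_sum => k _; rewrite ler_wpM2l ?sqr_ge0.
split => [i|l|i l]; rewrite ?rsumE ?csumE //.
(* The singular values are all grouped with [V], so only one factor [N] appears. *)
rewrite AEE; apply: le_trans (cauchy_schwarz_sum _ _ _ _) _.
have sqr_sum_ge0 (f : 'I_r -> RR) : 0 <= \sum_k f k ^+ 2.
  by apply: sumr_ge0 => k _; exact: sqr_ge0.
rewrite -mulrA; apply: ler_pM => //.
under eq_bigr do rewrite exprMn mulrC; exact: Vle.
Qed.

(** * The wedge matrix *)

Section WedgeDecomposition.
Variables (n m : nat) (A : 'M[RR]_(n, m)) (p : RR).
Local Notation T := ('I_n * 'I_m * 'I_n)%type.

Definition wedge_rate (t : T) : RR := if inW t then p else 0.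

(** Zero for [j < i], so that sums may range over all triples; on the diagonal [E_ii] counts
    once. *)
Definition pair_mx (i j : 'I_n) : 'M[RR]_n :=
  if (i < j)%N then delta_mx i j + delta_mx j i else delta_mx i j *+ (i == j).

Definition wedge_mx (t : T) : 'M[RR]_n :=
  (p^-1 * A t.1.1 t.1.2 * A t.2 t.1.2) *: pair_mx t.1.1 t.2.

Definition wedge_sqr (t : T) (x : 'I_n) : RR :=
  (p^-1 * A t.1.1 t.1.2 * A t.2 t.1.2) ^+ 2 *
  (inW t && ((x == t.1.1) || (x == t.2)))%:R.

Lemma weightE (w : Omega n m) : weight p w = bweight wedge_rate w.
Proof.
apply: eq_bigr => t _; rewrite /bern /wedge_rate.
by case: (inW t); case: (w t); rewrite ?subr0.
Qed.

Lemma pair_mx_sym i j : (pair_mx i j)^T = pair_mx i j.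
Proof.
rewrite /pair_mx; case: ifP => _.
  by rewrite linearD /= !trmx_delta addrC.
by case: eqP => [->|_]; rewrite ?mulr0n ?mulr1n ?trmx_delta ?trmx0.
Qed.

Lemma wedge_mx_sym t : (wedge_mx t)^T = wedge_mx t.
Proof. by rewrite linearZ /= pair_mx_sym. Qed.

(** [(E_ij + E_ji)^2 = E_ii + E_jj] for [i < j], and [E_ii] is idempotent. Outside [inW] both sides
    vanish. *)
Lemma wedge_mx_sqr t : wedge_mx t * wedge_mx t = diag_mx (\row_x wedge_sqr t x).
Proof.
case: t => -[i l] j; rewrite /wedge_mx /wedge_sqr /inW /= -mulmxE.
rewrite -scalemxAl -scalemxAr scalerA -expr2; set c := _ ^+ 2.
rewrite /pair_mx; case: ltngtP => ij.
- have jiF : (j == i) = false by apply/eqP => ji; rewrite ji ltnn in ij.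
  rewrite mulmxDl !mulmxDr !mul_delta_mx_cond !eqxx jiF eq_sym jiF !mulr0n !mulr1n.
  rewrite add0r addr0; apply/matrixP => x y; rewrite !mxE.
  case: (eqVneq x y) => [<-|xy]; rewrite ?mulr1n ?mulr0n.
    by case: (eqVneq x i) => [->|_]; rewrite ?(eq_sym i) ?jiF ?addr0 ?add0r ?andbb.
  case: (eqVneq x i) xy => [->|_] xy; rewrite ?add0r /=.
    by rewrite eq_sym (negPf xy) add0r eq_sym jiF mulr0.
  case: (eqVneq x j) xy => [->|_] xy; rewrite /= ?mulr0 //.
  by rewrite eq_sym (negPf xy) mulr0.
- have -> : (i == j) = false by apply/eqP => ji; rewrite ji ltnn in ij.
  rewrite mulr0n mulmx0 scaler0; apply/matrixP => x y.
  by rewrite !mxE mulr0 mul0rn.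
have {}ij : i = j by apply: val_inj.
rewrite -ij eqxx mulr1n mul_delta_mx; apply/matrixP => x y; rewrite !mxE orbb.
case: (eqVneq x y) => [<-|xy]; rewrite ?mulr1n ?mulr0n ?andbb //.
case: (eqVneq x i) xy => [->|_] xy; rewrite /= ?mulr0 //.
by rewrite eq_sym (negPf xy) mulr0.
Qed.

Lemma sum_pair_mx (c : 'I_n -> 'I_m -> 'I_n -> RR) :
  \sum_(t : T) c t.1.1 t.1.2 t.2 *: pair_mx t.1.1 t.2 =
  \sum_(i < n) \sum_(j < n | (i < j)%N) \sum_(l < m)
      (c i l j *: delta_mx i j + (c i l j *: delta_mx i j)^T)
  + \sum_(i < n) \sum_(l < m) c i l i *: delta_mx i i.
Proof.
rewrite -(pair_bigA _ (fun s j => c s.1 s.2 j *: pair_mx s.1 j)) /=.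
rewrite -(pair_bigA _ (fun i l => \sum_j c i l j *: pair_mx i j)) /=.
rewrite -big_split; apply: eq_bigr => i _ /=; rewrite exchange_big /=.
rewrite (bigID (fun j : 'I_n => (i < j)%N)) /=; congr (_ + _).
  apply: eq_bigr => j ij; apply: eq_bigr => l _.
  by rewrite /pair_mx ij scalerDr linearZ /= trmx_delta.
rewrite (bigD1 i) ?ltnn //= [X in _ + X]big1 ?addr0 => [|j /andP[/negPf ij /negPf ji]].
  by apply: eq_bigr => l _; rewrite /pair_mx ltnn eqxx mulr1n.
by rewrite big1 // => l _; rewrite /pair_mx ij eq_sym ji mulr0n scaler0.
Qed.

(** The fully sampled counterpart of the wedge matrix; the transposed terms supply the entries below
    the diagonal. *)
Lemma gram_pair_mx :
  A *m A^T = \sum_(t : T) (A t.1.1 t.1.2 * A t.2 t.1.2) *: pair_mx t.1.1 t.2.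
Proof.
rewrite (sum_pair_mx (fun i l j => A i l * A j l)).
have GE i j : (A *m A^T) i j = \sum_l A i l * A j l.
  by rewrite mxE; apply: eq_bigr => l _; rewrite mxE.
have GC i j : (A *m A^T) i j = (A *m A^T) j i.
  by rewrite !GE; apply: eq_bigr => l _; rewrite mulrC.
have -> : \sum_(i < n) \sum_(j < n | (i < j)%N) \sum_(l < m)
      (A i l * A j l *: delta_mx i j + (A i l * A j l *: delta_mx i j)^T) =
    \sum_(i < n) \sum_(j < n | (i < j)%N) (A *m A^T) i j *: delta_mx i j +
    \sum_(i < n) \sum_(j < n | (j < i)%N) (A *m A^T) i j *: delta_mx i j.
  rewrite [X in _ = _ + X](exchange_big_dep predT) //= -big_split.
  apply: eq_bigr => i _ /=; rewrite -big_split; apply: eq_bigr => j _ /=.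
  rewrite big_split -scaler_suml -GE; congr (_ + _).
  rewrite GC GE scaler_suml; apply: eq_bigr => l _.
  by rewrite linearZ /= trmx_delta mulrC.
rewrite {1}[A *m A^T]matrix_sum_delta -!big_split; apply: eq_bigr => i _ /=.
rewrite (bigID (fun j : 'I_n => (i < j)%N)) /= -addrA; congr (_ + _).
rewrite (bigD1 i) ?ltnn //= addrC -scaler_suml -GE; congr (_ + _).
apply: eq_bigl => j; rewrite -leqNgt ltn_neqAle andbC.
by rewrite -(inj_eq val_inj).
Qed.

Lemma wedge_centered (w : Omega n m) : p != 0 ->
  wedge A p w - A *m A^T = bern_mx wedge_rate wedge_mx w.
Proof.
move=> p0; rewrite gram_pair_mx /wedge /Zilj.
rewrite -(sum_pair_mx (fun i l j =>
    p^-1 * A i l * A j l * (if w ((i, l), j) then 1 else 0))).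
rewrite -sumrB; apply: eq_bigr => -[[i l] j] _ /=.
rewrite /wedge_mx /wedge_rate /inW /= -scalerBl scalerA.
have [ij|ij] := leqP i j.
  congr (_ *: _); case: (w _) => /=; field; exact: p0.
by rewrite /pair_mx ltnNge (ltnW ij) /= -(inj_eq val_inj) gtn_eqF // mulr0n !scaler0.
Qed.

End WedgeDecomposition.

(** * Tail bound for the wedge matrix of a nonzero incoherent matrix *)

Section WedgeConcentration.
Variables (n m r : nat) (A : 'M[RR]_(n, m)) (mu1 mu2 p : RR).
Hypothesis incA : incoherent A r mu1 mu2.
Hypothesis p01 : 0 < p <= 1.
Hypothesis A_neq0 : A != 0.

Local Notation alpha := (mu1 * r%:R / n%:R).
Local Notation beta := (mu2 * r%:R / m%:R).
Local Notation N := (spec_norm A ^+ 2).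
(** This is [mu1 mu2 r^2 / (p m n)], the ratio of the theorem without its factor [a log n]. *)
Local Notation nu := (alpha * beta / p).

Lemma wedge_rate01 t : 0 <= wedge_rate n m p t <= 1.
Proof.
have /andP[p0 p1] := p01; rewrite /wedge_rate; case: ifP => _.
  by rewrite ltW.
by rewrite lexx ler01.
Qed.

(** A nonzero entry of [A] has a positive square, which is at most [alpha * beta * N]. *)
Lemma nu_N_gt0 : 0 < nu * N.
Proof.
have /andP[p0 _] := p01; have [_ _ entry] := incoherent_bounds _ _ _ _ _ _ incA.
have [i [l Ail]] : exists i l, A i l != 0.
  apply: contra_notP (negP A_neq0) => nA; apply/eqP/matrixP => i l; rewrite mxE.
  by apply/eqP/negPn/negP => Ail; apply: nA; exists i, l.
rewrite mulrAC divr_gt0 //; apply: lt_le_trans (entry i l).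
by rewrite exprn_even_gt0.
Qed.

Lemma N_gt0 : 0 < N.
Proof.
rewrite lt0r sqr_ge0 andbT; apply/eqP => N0.
by have := nu_N_gt0; rewrite N0 mulr0 ltxx.
Qed.

Lemma nu_gt0 : 0 < nu.
Proof. by rewrite -(pmulr_lgt0 _ N_gt0) nu_N_gt0. Qed.

Lemma wedge_sqr_bound t x : 0 <= wedge_sqr n m A p t x <= (nu * N) ^+ 2.
Proof.
have /andP[p0 _] := p01; have [_ _ entry] := incoherent_bounds _ _ _ _ _ _ incA.
case: t => -[i l] j; rewrite /wedge_sqr /=; set c := _ ^+ 2.
have c0 : 0 <= c by exact: sqr_ge0.
have cle : c <= (nu * N) ^+ 2.
  have -> : nu * N = p^-1 * (alpha * beta * N) by ring.
  rewrite /c -mulrA [leLHS]exprMn [leRHS]exprMn ler_wpM2l ?sqr_ge0 //.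
  by rewrite exprMn [leRHS]expr2 ler_pM ?sqr_ge0.
by case: (inW _ && _); rewrite ?mulr1 ?mulr0 ?c0 ?lexx ?sqr_ge0.
Qed.

(** The rate [p] cancels one of the two factors [p^-1]. Summing over [j] uses the column bound, then
    over [l] the row bound; the factor 2 counts [x] as first and as last index. *)
Lemma wedge_sqr_var x :
  \sum_t wedge_rate n m p t * wedge_sqr n m A p t x <= (nu * N ^+ 2) *+ 2.
Proof.
have /andP[p0 _] := p01; have [row col _] := incoherent_bounds _ _ _ _ _ _ incA.
pose f (t : 'I_n * 'I_m * 'I_n) := p^-1 * (A t.1.1 t.1.2 ^+ 2 * A t.2 t.1.2 ^+ 2).
have f0 t : 0 <= f t.
  by apply: mulr_ge0; [rewrite invr_ge0 ltW|rewrite mulr_ge0 ?sqr_ge0].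
have key : \sum_l \sum_j A x l ^+ 2 * A j l ^+ 2 <= alpha * beta * N ^+ 2.
  apply: (@le_trans _ _ (\sum_l A x l ^+ 2 * (beta * N))).
    by apply: ler_sum => l _; rewrite -mulr_sumr ler_wpM2l ?sqr_ge0.
  rewrite -mulr_suml [leRHS](_ : _ = alpha * N * (beta * N)); last by ring.
  (* An index [l] is needed to read [0 <= beta * N] off a column norm. *)
  have [l _|noI] := pickP 'I_m; last first.
    rewrite big1 => [|l]; last by have := noI l.
    rewrite mul0r (_ : _ * _ = alpha * beta * N ^+ 2); last by ring.
    rewrite mulr_ge0 ?sqr_ge0 //.
    by rewrite -(pmulr_lge0 _ (_ : 0 < p^-1)) ?invr_gt0 // ltW ?nu_gt0.
  rewrite ler_wpM2r //; apply: le_trans (col l).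
  by apply: sumr_ge0 => j _; exact: sqr_ge0.
apply: (@le_trans _ _ (\sum_t (f t * (x == t.1.1)%:R + f t * (x == t.2)%:R))).
  apply: ler_sum => t _; rewrite /wedge_rate /wedge_sqr; case: (inW t); last first.
    by rewrite mul0r addr_ge0 // mulr_ge0.
  rewrite andTb mulrA.
  have -> : p * (p^-1 * A t.1.1 t.1.2 * A t.2 t.1.2) ^+ 2 = f t.
    by rewrite /f; field; rewrite gt_eqF.
  rewrite -mulrDr ler_wpM2l //.
  by case: (x == t.1.1); case: (x == t.2); rewrite /= ?addr0 ?add0r ?lerDl.
rewrite big_split mulr2n /=.
have nuE : nu * N ^+ 2 = p^-1 * (alpha * beta * N ^+ 2) by ring.
have pV0 : 0 <= p^-1 by rewrite invr_ge0 ltW.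
apply: lerD; rewrite nuE; apply: le_trans (ler_wpM2l pV0 key);
  rewrite mulr_sumr /f.
- rewrite -(pair_bigA _ (fun s j =>
    p^-1 * (A s.1 s.2 ^+ 2 * A j s.2 ^+ 2) * (x == s.1)%:R)) /=.
  rewrite -(pair_bigA _ (fun i l =>
    \sum_j p^-1 * (A i l ^+ 2 * A j l ^+ 2) * (x == i)%:R)) /=.
  rewrite (bigD1 x) //= [X in _ + X]big1 ?addr0 => [|i /negPf ix]; last first.
    by rewrite eq_sym ix !big1 // => l _; rewrite big1 // => j _; rewrite mulr0.
  apply: ler_sum => l _; rewrite mulr_sumr; apply: ler_sum => j _.
  by rewrite eqxx mulr1.
- rewrite -(pair_bigA _ (fun s j =>
    p^-1 * (A s.1 s.2 ^+ 2 * A j s.2 ^+ 2) * (x == j)%:R)) /=.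
  rewrite -(pair_bigA _ (fun i l =>
    \sum_j p^-1 * (A i l ^+ 2 * A j l ^+ 2) * (x == j)%:R)) /=.
  rewrite exchange_big; apply: ler_sum => l _ /=.
  rewrite mulr_sumr; apply: ler_sum => i _.
  rewrite (bigD1 x) //= [X in _ + X]big1 ?addr0 => [|j /negPf jx]; last first.
    by rewrite eq_sym jx mulr0.
  by rewrite eqxx mulr1 [A i l ^+ 2 * _]mulrC.
Qed.

Lemma wedge_trace_moment_le u :
  bexp (wedge_rate n m p)
    (fun w => \tr (bern_mx (wedge_rate n m p) (wedge_mx n m A p) w ^+ u.+1.*2)) <=
  n%:R * (4 * u.+1%:R * ((nu * N ^+ 2) *+ 2 *+ 2 + u.+1%:R * (nu * N) ^+ 2)) ^+ u.+1.
Proof.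
apply: trace_moment_le.
- exact: wedge_rate01.
- exact: wedge_mx_sym.
- exact: wedge_mx_sqr.
- exact: wedge_sqr_bound.
- exact: sqr_ge0.
- exact: wedge_sqr_var.
Qed.

Lemma prob_markov (E : Omega n m -> Prop) (f : Omega n m -> RR) (c d : RR) :
  0 < c -> (forall w, 0 <= f w) -> (forall w, ~ E w -> c <= f w) ->
  bexp (wedge_rate n m p) f <= d * c -> 1 - d <= prob p E.
Proof.
move=> c0 f0 fE le_d.
have b0 w := bweight_ge0 _ _ _ wedge_rate01 w.
rewrite lerBlDr -lerBlDl -(ler_pM2r c0) (le_trans _ le_d) //.
rewrite -(bexp1 _ _ (wedge_rate n m p)) /bexp /prob -sumrB mulr_suml.
apply: ler_sum => w _; rewrite weightE mulr1; case: asboolP => Ew.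
  by rewrite subrr mul0r mulr_ge0.
by rewrite subr0 ler_wpM2l ?fE.
Qed.

Lemma wedge_tail (a : RR) : (1 < n)%N -> 2 < a ->
  1 - n%:R `^ (- a) <=
    prob p (fun w : Omega n m =>
      spec_norm (wedge A p w - A *m A^T) <=
      6 * expR 1 * (Num.sqrt (nu * (a * ln n%:R)) + nu * (a * ln n%:R)) * N).
Proof.
move=> n1 a2; set tau := a * ln n%:R; set y := nu * tau.
set thr := 6 * _ * _ * _.
have /andP[p0 _] := p01.
have n0 : 0 < n%:R :> RR by rewrite ltr0n; apply: leq_trans n1.
(* From [ln (1 - 1/2) <= -1/2] and [n >= 2]. With [a > 2] it gives [tau >= 1], hence [k <= 2 * tau]
   below. *)
have ln_half : 2^-1 <= ln n%:R :> RR.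
  have : ln (1 + - 2^-1) <= - 2^-1 :> RR by apply: le_ln1Dx; lra.
  rewrite (_ : 1 + - 2^-1 = 2^-1 :> RR); last by field.
  rewrite lnV ?posrE ?ltr0n // lerN2 => /le_trans; apply.
  by rewrite ler_ln ?posrE // ler_nat.
have tau1 : 1 <= tau by rewrite /tau; nra.
have ln_tau : ln n%:R <= tau by rewrite /tau; nra.
have y0 : 0 < y by rewrite mulr_gt0 ?nu_gt0 //; lra.
pose u := Num.truncn tau; pose k : RR := u.+1%:R.
have ktau : tau < k by rewrite /k truncnS_gt.
have k2 : k <= 2 * tau.
  have := @truncn_itv _ tau; rewrite -/u => /(_ _)/andP[|utau _]; first lra.
  by rewrite /k -natr1; lra.
have thr0 : 0 < thr.
  rewrite /thr mulr_gt0 ?N_gt0 // mulr_gt0 ?mulr_gt0 ?expR_gt0 //.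
  by rewrite ltr_wpDl ?sqrtr_ge0.
(* The constant [6 e] is fixed here. With [z = k * nu <= 2 * y] the left side is
   [4 (4 z + z^2) N^2 <= 32 (y + y^2) N^2], and [36 = 6^2] exceeds 32; the factor [e] in [thr] pays
   for [expR (- 2)]. *)
have Q_le : 4 * k * ((nu * N ^+ 2) *+ 2 *+ 2 + k * (nu * N) ^+ 2) <=
    thr ^+ 2 * expR (- 2).
  have thrE : thr ^+ 2 * expR (- 2) = 36 * (Num.sqrt y + y) ^+ 2 * N ^+ 2.
    rewrite (_ : thr = expR 1 * (6 * (Num.sqrt y + y) * N)); last first.
      by rewrite /thr; ring.
    by rewrite exprMn -expRM_natl mulr1 mulrAC -exp.expRD subrr exp.expR0; ring.
  rewrite thrE; apply: (@le_trans _ _ (32 * (y + y ^+ 2) * N ^+ 2)).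
    rewrite [leLHS](_ : _ = 4 * (4 * (k * nu) + (k * nu) ^+ 2) * N ^+ 2);
      last by ring.
    rewrite ler_wpM2r ?sqr_ge0 //.
    have : 0 <= k * nu by rewrite mulr_ge0 // ltW ?nu_gt0.
    have : k * nu <= 2 * y by rewrite [leRHS]mulrCA [leLHS]mulrC ler_wpM2l // ltW ?nu_gt0.
    move: y0; set z := k * nu; nra.
  rewrite ler_wpM2r ?sqr_ge0 //.
  have := sqr_sqrtr (ltW y0); have := sqrtr_ge0 y; set s := Num.sqrt y => s0 sy.
  nra.
apply: (@prob_markov _ (fun w =>
    \tr (bern_mx (wedge_rate n m p) (wedge_mx n m A p) w ^+ u.+1.*2)) (thr ^+ u.+1.*2)).
- by rewrite exprn_gt0.
- move=> w; rewrite -addnn exprD -{1}(trmx_exp_sym _ _ _ _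
    (bern_mx_sym _ _ _ _ _ (wedge_mx_sym _ _ _ _) w)).
  exact: mxtrace_trMM_ge0.
- move=> w /negP; rewrite -ltNge wedge_centered ?gt_eqF // => lt_thr.
  rewrite leNgt; apply/negP => /ltW /spec_norm_exp_le_trace.
  move=> /(_ (bern_mx_sym _ _ _ _ _ (wedge_mx_sym _ _ _ _) w) (ltW thr0)).
  by rewrite leNgt lt_thr.
apply: (le_trans (wedge_trace_moment_le u)).
apply: (@le_trans _ _ (n%:R * (thr ^+ 2 * expR (- 2)) ^+ u.+1)).
  rewrite ler_wpM2l ?(ltW n0) // lerXn2r ?nnegrE //.
    apply: mulr_ge0; first by rewrite mulr_ge0 ?ler0n.
    apply: addr_ge0; last by apply: mulr_ge0; rewrite ?sqr_ge0.
    by do 2!apply: mulrn_wge0; apply: (mulr_ge0 (ltW nu_gt0)); rewrite sqr_ge0.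
  by rewrite mulr_ge0 ?sqr_ge0 ?(ltW (expR_gt0 _)).
(* Once the power of [thr] cancels, [n e^(-2k) <= n^(-a)] remains, that is [ln n - 2k <= -tau],
   which follows from [ln n <= tau < k]. *)
rewrite exprMn -exprM mul2n mulrCA mulrC ler_wpM2r ?exprn_ge0 ?(ltW thr0) //.
rewrite -expRM_natl /powR gt_eqF // -[X in X * _](lnK (n0 : n%:R \is Num.pos)).
rewrite -exp.expRD ler_expR -/k mulNr -/tau; lra.
Qed.

End WedgeConcentration.

Theorem theorem3p1 :
  exists C : RR, 0 < C /\ exists K : RR, 0 < K /\
  forall (n m r : nat) (A : 'M[RR]_(n, m)) (mu1 mu2 p a : RR),
    \rank A = r ->
    incoherent A r mu1 mu2 ->
    0 < p <= 1 ->
    2 < a ->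
    1 - K * (n%:R `^ (- a)) <=
    prob p (fun w =>
      spec_norm (wedge A p w - A *m A^T) <=
      C * (Num.sqrt (a * mu1 * mu2 * (r%:R ^+ 2) * ln n%:R / (p * m%:R * n%:R))
           + a * mu1 * mu2 * (r%:R ^+ 2) * ln n%:R / (p * m%:R * n%:R))
        * spec_norm A ^+ 2).
Proof.
exists (6 * expR 1); split; first by rewrite mulr_gt0 ?expR_gt0.
exists 1; split=> // n m r A mu1 mu2 p a rkA incA p01 a2; rewrite mul1r.
have w0 w := bweight_ge0 _ _ _ (wedge_rate01 n m p p01) w.
(* For [A = 0] the rank is 0 and both sides of the norm bound vanish, so the event has probability
   1. *)
have [A0|A_neq0] := eqVneq A 0.
  have r0 : r = 0%N by rewrite -rkA A0 mxrank0.
  apply: (@le_trans _ _ 1); first by rewrite gerBl powR_ge0.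
  rewrite -(bexp1 _ _ (wedge_rate n m p)); apply: ler_sum => w _.
  rewrite mulr1 weightE; case: asboolP => // -[].
  rewrite wedge_centered ?gt_eqF //; last by case/andP: p01.
  rewrite r0 expr0n /= !mulr0 !mul0r sqrtr0 addr0 mulr0 mul0r.
  apply: spec_norm_le => x _; rewrite /bern_mx big1 => [|t _]; last first.
    by rewrite /wedge_mx A0 !mxE !mulr0 scale0r scaler0.
  by rewrite mul0mx /vnorm2 big1 ?sqrtr0 // => i _; rewrite mxE expr0n.
(* For [n = 1] the claimed lower bound on the probability is 0; [n = 0] would force [A = 0]. *)
have [n1|n1] := ltnP 1 n; last first.
  apply: (@le_trans _ _ 0); last first.
    by apply: sumr_ge0 => w _; rewrite weightE; case: ifP.
  case: n n1 A {rkA incA w0} A_neq0 => [|[|//]] _ A A_neq0.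
    by rewrite [A]flatmx0 eqxx in A_neq0.
  by rewrite powR1 subrr.
have yE : a * mu1 * mu2 * r%:R ^+ 2 * ln n%:R / (p * m%:R * n%:R) =
    mu1 * r%:R / n%:R * (mu2 * r%:R / m%:R) / p * (a * ln n%:R).
  by rewrite !invfM; ring.
by rewrite yE; apply: wedge_tail.
Qed.
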